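(* Let $\mathfrak{A}$ be a residuated lattice. Then $(Min(\mathfrak{A});\tau_d)$ is compact, where $\tau_d$ is the dual hull-kernel topology.
   Context: A residuated lattice is an algebra $\mathfrak{A}=(A;\vee,\wedge,\odot,\rightarrow,0,1)$ such that $(A;\vee,\wedge,0,1)$ is a bounded lattice, $(A;\odot,1)$ is a commutative monoid, and $(\odot,\rightarrow)$ is an adjoint pair, i.e. $x\odot y\le z$ iff $x\le y\rightarrow z$. A filter of $\mathfrak{A}$ is a non-empty subset $F\subseteq A$ such that $x,y\in F$ implies $x\odot y\in F$, and $x\in F$, $y\in A$ imply $x\vee y\in F$. A filter is proper if it is not equal to $A$. A proper filter $P$ is prime if for all filters $F_1,F_2$, $F_1\cap F_2=P$ implies $F_1=P$ or $F_2=P$. $Min(\mathfrak{A})$ is the set of minimal prime filters (minimal elements, under inclusion, among all prime filters). The dual hull-kernel topology $\tau_d$ on $Min(\mathfrak{A})$ is the topology having the sets $h(x)=\{P\in Min(\mathfrak{A})\mid x\in P\}$, $x\in A$, as a base of open sets. Compactness does not include the Hausdorff condition. *)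

(* Defs.v *)
From HB Require Import structures.
From mathcomp Require Import all_boot all_order.
From mathcomp Require Import all_classical.
From mathcomp Require Import topology.

Set Implicit Arguments.
Unset Strict Implicit.
Unset Printing Implicit Defensive.

Import Order.TTheory.
Local Open Scope classical_set_scope.
Local Open Scope order_scope.

HB.mixin Record TBLattice_isResiduated d T & Order.TBLattice d T := {
  odot : T -> T -> T;
  imp : T -> T -> T;
  odotA : associative odot;
  odotC : commutative odot;
  odot1x : left_id \top odot;
  odot_adjoint : forall x y z : T, (odot x y <= z) = (x <= imp y z)
}.

#[short(type="residuatedLatticeType")]
HB.structure Definition ResiduatedLattice d :=
  {T of Order.TBLattice d T & TBLattice_isResiduated d T}.

Section Filters.
Context {d : Order.disp_t} {A : residuatedLatticeType d}.
Implicit Types (F P Q : set A) (x y : A).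

Definition is_filter F : Prop :=
  [/\ F !=set0,
      forall x y, F x -> F y -> F (odot x y) &
      forall x y, F x -> F (x `|` y)].

Definition proper_filter F : Prop := is_filter F /\ F <> [set: A].

Definition prime_filter P : Prop :=
  proper_filter P /\
  forall F1 F2, is_filter F1 -> is_filter F2 ->
    (F1 `&` F2)%classic = P -> F1 = P \/ F2 = P.

Definition minimal_prime_filter P : Prop :=
  prime_filter P /\
  forall Q, prime_filter Q -> (Q `<=` P)%classic -> Q = P.

Lemma odot_lel x y : odot x y <= x.
Proof.
have le1 : (\top : A) <= imp x x by rewrite -odot_adjoint odot1x.
by rewrite odotC odot_adjoint (le_trans (lex1 y) le1).
Qed.

Lemma is_filter_le F x y : is_filter F -> x <= y -> F x -> F y.
Proof. by case=> _ _ FU /join_idPl <- Fx; rewrite joinC; apply: FU. Qed.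

Lemma is_filter_odot F x y : is_filter F -> F (odot x y) <-> F x /\ F y.
Proof.
move=> fF; split=> [Fxy|[Fx Fy]]; last by case: fF => _ + _; apply.
split; apply: is_filter_le fF _ Fxy; first exact: odot_lel.
by rewrite odotC odot_lel.
Qed.

Lemma is_filter_top F : is_filter F -> F \top.
Proof. by move=> fF; case: (fF) => -[x Fx] _ _; apply: is_filter_le (lex1 x) _. Qed.

End Filters.

(* Named so that the topology instance below is attached to [minSpec] and not
   to [set_type], i.e. to every sigma type. *)
Definition minSpec d (A : residuatedLatticeType d) : Type :=
  set_type [set P : set A | minimal_prime_filter P].

HB.instance Definition _ d (A : residuatedLatticeType d) :=
  Choice.on (minSpec A).

Section DualHullKernel.
Context {d : Order.disp_t} {A : residuatedLatticeType d}.

Definition min_val (P : minSpec A) : set A := \val P.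

Definition hull (x : A) : set (minSpec A) := [set P | min_val P x].

Lemma min_valP (P : minSpec A) : minimal_prime_filter (min_val P).
Proof. exact: set_mem (valP P). Qed.

Lemma min_val_filter (P : minSpec A) : is_filter (min_val P).
Proof. by case: (min_valP P) => -[[]]. Qed.

Lemma hull_top : hull \top = [set: minSpec A].
Proof.
by apply/seteqP; split=> // P _; apply: is_filter_top; apply: min_val_filter.
Qed.

Lemma hull_odot x y : hull (odot x y) = (hull x `&` hull y)%classic.
Proof.
apply/seteqP; split=> P; have fP := min_val_filter P;
  by rewrite /hull /= (is_filter_odot _ _ fP).
Qed.

Let hull_cover : \bigcup_(U in range hull) U = [set: minSpec A].
Proof.
by apply/seteqP; split=> // P _; exists (hull \top); [exists \top | rewrite hull_top].
Qed.

Let hull_join (U V : set (minSpec A)) (P : minSpec A) :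
  range hull U -> range hull V -> U P -> V P ->
  exists W, [/\ range hull W, W P & (W `<=` U `&` V)%classic].
Proof.
move=> [x _ <-] [y _ <-] xP yP; exists (hull (odot x y)).
by rewrite hull_odot; split=> //; exists (odot x y); rewrite ?hull_odot.
Qed.

(* The base is the family of sets [hull x], indexed by itself because the
   factory wants a pointed index type, which [A] is not. *)
HB.instance Definition _ :=
  @isBaseTopological.Build (minSpec A) (set (minSpec A)) (range hull) id
    hull_cover hull_join.

Lemma open_minSpecE (U : set (minSpec A)) :
  open U <-> exists X : set A, U = \bigcup_(x in X) hull x.
Proof.
split=> [[D DB <-]|[X ->]].
  exists [set x | D (hull x)]; apply/seteqP; split=> P [].
    by move=> V DV VP; have [x _ xV] := DB _ DV; exists x; rewrite /= xV.
  by move=> x Dx Px; exists (hull x).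
exists (hull @` X); first by move=> _ [x _ <-]; exists x.
by rewrite bigcup_image.
Qed.

End DualHullKernel.

(* Main.v *)
(** A lattice ideal [M] maximal among those avoiding [\top] satisfies: every
    [x] outside [M] has some [i] in [M] with [x `|` i = \top].  Since
    [odot (x `|` i) (y `|` i) <= odot x y `|` i], this makes the complement of
    [M] a filter, and in fact a minimal prime one.  For a proper filter [F] on
    the minimal spectrum, the elements [x] such that [F] contains the complement
    of [hull x] form an ideal avoiding [\top]; extending it to a maximal [M]
    gives a minimal prime filter that is a cluster point of [F]. *)
Require Import Defs.
From mathcomp Require Import all_boot all_order all_classical topology.

Local Open Scope classical_set_scope.

Section MinimalPrimes.
Set Implicit Arguments.
Unset Strict Implicit.
Import Order.TTheory.
Local Open Scope order_scope.
Context {d : Order.disp_t} {A : residuatedLatticeType d}.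
Implicit Types (P Q J M : set A) (x y z : A).

Lemma odot_joinl x y z : odot (x `|` y) z <= odot x z `|` odot y z.
Proof.
by rewrite odot_adjoint leUx -!odot_adjoint leUl leUr.
Qed.

(** Distributing [odot] over both joins leaves [odot x y] and products having [z] as a factor, and
    these lie below [z]. *)
Lemma odot_join_le x y z : odot (x `|` z) (y `|` z) <= odot x y `|` z.
Proof.
apply: le_trans (odot_joinl _ _ _) _; rewrite leUx; apply/andP; split.
  rewrite odotC; apply: le_trans (odot_joinl _ _ _) _.
  by rewrite odotC leU2 // odot_lel.
by apply: le_trans (odot_lel _ _) _; exact: leUr.
Qed.

Lemma prime_filter_join P x y : prime_filter P -> P (x `|` y) -> P x \/ P y.
Proof.
move=> [[fP _] prP] Pxy.
(* [F1] and [F2] are relative annihilators modulo [P], so they meet in [P]. *)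
pose F1 : set A := [set z | P (z `|` x)].
pose F2 : set A := [set z | forall v, F1 v -> P (z `|` v)].
have FP x' y' : P x' -> x' <= y' -> P y'.
  by move=> + le; apply: is_filter_le.
have fF1 : is_filter F1.
  split.
  - by exists y; rewrite /F1 /= joinC.
  - move=> z w zF wF; apply: FP (odot_join_le _ _ _).
    exact/(is_filter_odot _ _ fP).
  - by move=> z w zF; apply: FP zF _; rewrite leU2 // leUl.
have fF2 : is_filter F2.
  split.
  - by exists x => v; rewrite joinC.
  - move=> z w zF wF v vF; apply: FP (odot_join_le _ _ _).
    by apply/(is_filter_odot _ _ fP); split; [exact: zF | exact: wF].
  - by move=> z w zF v vF; apply: FP (zF v vF) _; rewrite leU2 // leUl.
(* An element [z] of both filters may be tested against [v := z]. Moreover [y] is in [F1] and [x] is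
   in [F2], so whichever filter equals [P] settles the claim. *)
have F12 : (F1 `&` F2)%classic = P.
  apply/seteqP; split=> z; first by move=> [z1 /(_ _ z1)]; rewrite joinxx.
  by move=> Pz; split=> [|v _]; apply: FP Pz _; exact: leUl.
case: (prP _ _ fF1 fF2 F12) => eP.
  by right; rewrite -eP /F1 /= joinC.
by left; rewrite -eP => v; rewrite joinC.
Qed.

Definition proper_ideal J : Prop :=
  [/\ J \bot, ~ J \top, forall x y, y <= x -> J x -> J y &
      forall x y, J x -> J y -> J (x `|` y)].

Definition maximal_ideal M : Prop :=
  proper_ideal M /\ forall J, proper_ideal J -> (M `<=` J)%classic -> J = M.

Lemma ex_maximal_ideal J : proper_ideal J ->
  exists2 M, maximal_ideal M & (J `<=` M)%classic.
Proof.
move=> idJ.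
(* The union with [J] lets the empty chain have an upper bound. *)
pose S := [set B : set A | proper_ideal (B `|` J)%classic].
have chainS (C : set (set A)) : (C `<=` S)%classic ->
    total_on C (@subset A) -> S (\bigcup_(X in C) X)%classic.
  move=> CS totC; case: (idJ) => J0 J1 Jle JU; split.
  - by right.
  - by case=> [[B CB B1]|//]; have [_ + _ _] := CS _ CB; apply; left.
  - move=> x y yx [[B CB Bx]|Jx]; last by right; exact: Jle yx Jx.
    have [_ _ Ble _] := CS _ CB.
    by case: (Ble x y yx (or_introl Bx)); [left; exists B | right].
  - move=> x y; case=> [[B CB Bx]|Jx]; case=> [[D CD Dy]|Jy].
    + have [BD|DB] := totC _ _ CB CD.
        have [_ _ _ DU] := CS _ CD.
        case: (DU x y); [by left; exact: BD | by left | by left; exists D |].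
        by right.
      have [_ _ _ BU] := CS _ CB.
      case: (BU x y); [by left | by left; exact: DB | by left; exists B |].
      by right.
    + have [_ _ _ BU] := CS _ CB.
      by case: (BU x y); [left | right | left; exists B | right].
    + have [_ _ _ DU] := CS _ CD.
      by case: (DU x y); [right | left | left; exists D | right].
    + by right; exact: JU.
have [M [SM maxM]] := Zorn_bigcup chainS.
exists (M `|` J)%classic; last by move=> x; right.
split=> // K idK MK.
(* As [K] contains [J], it belongs to [S] and so cannot properly contain [M]. *)
have KJ : (K `|` J = K)%classic.
  by apply/setUidl => x Jx; apply: MK; right.
have [KM|nKM] := pselect (K `<=` M)%classic.
  by apply/seteqP; split=> // x /KM; left.
exfalso; apply: (maxM K); last by rewrite /S /= KJ.
by split=> // x Mx; apply: MK; left.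
Qed.

(** Otherwise the ideal [K] generated by [M] and [x] would still avoid [\top], and maximality would
    put [x] in [M]. *)
Lemma maximal_ideal_compl M x : maximal_ideal M -> ~ M x ->
  exists2 i, M i & x `|` i = \top.
Proof.
move=> [[M0 M1 Mle MU] maxM] nMx; apply: contrapT => noi.
pose K : set A := [set z | exists2 i, M i & z <= x `|` i].
suff KM : K = M by apply: nMx; rewrite -KM; exists \bot => //; exact: leUl.
apply: maxM => [|z Mz]; last by exists z => //; exact: leUr.
split.
- by exists \bot => //; exact: le0x.
- by move=> [i Mi]; rewrite le1x => /eqP xi; apply: noi; exists i.
- by move=> z y yz [i Mi zi]; exists i => //; exact: le_trans zi.
- move=> z y [i Mi zi] [j Mj yj]; exists (i `|` j); first exact: MU.
  rewrite leUx (le_trans zi) ?(le_trans yj) // leU2 //; first exact: leUr.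
  exact: leUl.
Qed.

Lemma maximal_ideal_minimal_prime M :
  maximal_ideal M -> minimal_prime_filter (~` M)%classic.
Proof.
move=> maxM; have [[M0 M1 Mle MU] _] := maxM.
have fP : is_filter (~` M)%classic.
  split; first by exists \top.
  - move=> x y nx ny.
    have [i Mi xi] := maximal_ideal_compl maxM nx.
    have [j Mj yj] := maximal_ideal_compl maxM ny.
    (* With [k := i]|[j], both [x]|[k] and [y]|[k] are [\top], hence so is [odot x y]|[k], a join of
       two elements of [M]. *)
    move=> Mxy; apply: M1; apply: (Mle (odot x y `|` (i `|` j))); last first.
      by apply: (MU) => //; exact: MU.
    apply: le_trans (odot_join_le _ _ _).
    by rewrite joinA xi (joinC i) joinA yj !join1x odot1x.
  - by move=> x y nx Mxy; apply: nx; apply: Mle Mxy; exact: leUl.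
split; first split.
- by split=> // MT; have : (~` M)%classic \bot; [rewrite MT | exact].
- move=> F1 F2 fF1 fF2 F12.
  (* If neither filter avoids [M], the join of a witness from each lies in both filters and in
     [M]. *)
  have [F1P|/existsNP[x /not_implyP[F1x Mx]]] :=
    pselect (F1 `<=` ~` M)%classic.
    by left; apply/seteqP; split=> // x; rewrite -F12 => -[].
  have [F2P|/existsNP[y /not_implyP[F2y My]]] :=
    pselect (F2 `<=` ~` M)%classic.
    by right; apply/seteqP; split=> // z; rewrite -F12 => -[].
  have : (F1 `&` F2)%classic (x `|` y).
    by split; [apply: is_filter_le F1x | apply: is_filter_le F2y];
      rewrite ?leUl ?leUr.
  by rewrite F12 => nMxy; case: nMxy; apply: MU; exact: contrapT.
(* Primeness of [Q] splits [x]|[i = \top], and [i] is not in [Q] because it is in [M]. *)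
- move=> Q prQ QP; apply/seteqP; split=> // x nMx.
  have [i Mi xi] := maximal_ideal_compl maxM nMx.
  have : Q (x `|` i) by rewrite xi; apply: is_filter_top; case: prQ => -[].
  by case/(prime_filter_join prQ) => // /QP.
Qed.

Lemma hull_join (x y : A) : hull (x `|` y) = (hull x `|` hull y)%classic.
Proof.
apply/seteqP; split=> P.
  by apply: prime_filter_join; case: (min_valP P).
have fP := min_val_filter P.
by case=> [Px|Py]; [apply: is_filter_le Px | apply: is_filter_le Py];
  rewrite ?leUl ?leUr.
Qed.

Lemma hull_bot : hull (\bot : A) = set0.
Proof.
apply/seteqP; split=> // P P0; case: (min_valP P) => -[[fP nT] _] _; apply: nT.
by apply/seteqP; split=> // x _; apply: is_filter_le (le0x x) P0.
Qed.

Lemma hull_le (x y : A) : x <= y -> (hull x `<=` hull y)%classic.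
Proof. by move=> xy P; apply: is_filter_le xy; exact: min_val_filter. Qed.

End MinimalPrimes.

Theorem theorem4p2 (d : Order.disp_t) (A : residuatedLatticeType d) :
  compact [set: minSpec A].
Proof.
move=> F PF _.
pose J : set A := [set x | F (~` hull x)].
have idJ : proper_ideal J.
  split; rewrite /J /=.
  - by rewrite hull_bot setC0; exact: filterT.
  - by rewrite hull_top setCT; exact: filter_not_empty.
  - by move=> x y yx; apply: filterS; apply: subsetC; exact: hull_le.
  - by move=> x y Fx Fy; rewrite hull_join setCU; exact: filterI.
have [M maxM JM] := ex_maximal_ideal idJ.
pose P : minSpec A := SigSub (mem_set (maximal_ideal_minimal_prime maxM)).
exists P; split=> // G U FG; rewrite nbhsE => -[V [oV VP] VU].
have [X eV] := (open_minSpecE V).1 oV.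
move: VP; rewrite eV => -[x Xx Px].
(* If [G] missed [U], it would miss [hull x], which puts [x] in [J] and thus in [M], against
   [Px]. *)
apply: contrapT => GU0.
suff : M x by exact: Px.
apply: JM; rewrite /J /=; apply: filterS FG => Q GQ Qx; apply: GU0.
by exists Q; split=> //; apply: VU; rewrite eV; exists x.
Qed.
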